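(* Let $\mathcal{A}$ be an arrangement in $V=\mathbb{K}^\ell$, $H\in\mathcal{A}$, $\mathcal{A}'=\mathcal{A}\setminus\{H\}$, and $0\le p\le\ell$. Then $D^p(\mathcal{A})\subseteq D^p(\mathcal{A}')$, the map $\overline{\partial^p}$ sends $D^p(\mathcal{A}')$ into $D^{p-1}(\mathcal{A}^H)\overline{B}$, and the sequence $$0\to D^p(\mathcal{A})\to D^p(\mathcal{A}')\xrightarrow{\overline{\partial^p}} D^{p-1}(\mathcal{A}^H)\overline{B}$$ (first map the inclusion) is exact.
   Context: $\mathbb{K}$ a field, $S=\mathbb{K}[x_1,\dots,x_\ell]$. For an arrangement (finite set of linear hyperplanes) $\mathcal{A}$, $\alpha_H$ denotes a defining linear form of $H$ and $Q(\mathcal{A})=\prod_{H\in\mathcal{A}}\alpha_H$. $\operatorname{Der}^pS=\wedge^p_S\operatorname{Der}S$, elements viewed as alternating $S$-multilinear maps $S^p\to S$ that are derivations in each argument; $D^p(\mathcal{A})=\{\theta\in\operatorname{Der}^pS:\theta(\alpha_H,f_2,\dots,f_p)\in\alpha_HS\ \forall H\in\mathcal{A},f_j\in S\}$, $D^0(\mathcal{A})=S$. $\overline{S}=S/\alpha_HS$, bar denotes image in $\overline{S}$; $\mathcal{A}^H=\{L\cap H:L\in\mathcal{A}'\}$ is an arrangement in $H$ and $D^{q}(\mathcal{A}^H)\subset\wedge^q\operatorname{Der}\overline{S}$ is defined analogously, with $D^{-1}(\mathcal{A}^H):=0$. $Q(\mathcal{A}^H)\in\overline{S}$ is the product of defining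 forms of the hyperplanes of $\mathcal{A}^H$; it divides $\overline{Q(\mathcal{A}')}$ and $\overline{B}:=\overline{Q(\mathcal{A}')}/Q(\mathcal{A}^H)\in\overline{S}$ (homogeneous of degree $|\mathcal{A}'|-|\mathcal{A}^H|$). $D^{p-1}(\mathcal{A}^H)\overline{B}=\{\overline{B}\varphi:\varphi\in D^{p-1}(\mathcal{A}^H)\}$. For $p\ge1$, $\overline{\partial^p}:D^p(\mathcal{A}')\to\wedge^{p-1}\operatorname{Der}\overline{S}$ is $\overline{\partial^p}(\theta)(\overline{f_2},\dots,\overline{f_p})=\overline{\theta(\alpha_H,f_2,\dots,f_p)}$ (for $p=1$, $\overline{\partial^1}(\theta)=\overline{\theta(\alpha_H)}\in\overline{S}$), and $\overline{\partial^0}:=0$. *)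

(* Defs.v *)
From HB Require Import structures.
From mathcomp Require Import all_boot all_algebra finmap mpoly.
From mathcomp Require Import generic_quotient ring_quotient.
From mathcomp Require Import ring.
From Stdlib Require Import Classical ClassicalEpsilon.

Set Implicit Arguments.
Unset Strict Implicit.
Unset Printing Implicit Defensive.

Import GRing.Theory.
Local Open Scope fset_scope.
Local Open Scope ring_scope.
Local Open Scope quotient_scope.

Definition rdvd (R : comNzRingType) (a b : R) : Prop := exists c, b = c * a.

Section Multiderivations.

Variables (K : fieldType) (R : comAlgType K).

Definition tsubst p (f : p.-tuple R) (i : 'I_p) (g : R) : p.-tuple R :=
  [tuple if j == i then g else tnth f j | j < p].

Definition is_derivation (D : R -> R) : Prop :=
  linear D /\ (forall g h : R, D (g * h) = g * D h + h * D g).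

(* Over a free module of derivations this is the p-th exterior power. The
   alternating condition is the strong one, correct in characteristic 2. *)
Definition is_multider p (theta : p.-tuple R -> R) : Prop :=
  (forall (f : p.-tuple R) (i : 'I_p),
      is_derivation (fun g => theta (tsubst f i g)))
  /\ (forall (f : p.-tuple R) (i j : 'I_p),
      i != j -> tnth f i = tnth f j -> theta f = 0).

(* [form X] is the chosen defining form of the hyperplane X of the
   arrangement A, as an element of the coordinate ring R. *)
Definition logder (T : choiceType) (A : {fset T}) (form : T -> R) p :
    (p.-tuple R -> R) -> Prop :=
  match p with
  | 0 => fun theta => is_multider theta
  | q.+1 => fun theta => is_multider theta /\
      forall X, X \in A -> forall f : q.-tuple R,
        rdvd (form X) (theta [tuple of form X :: f])
  end.

(* D^(p-1), with D^(-1) = 0. *)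
Definition logder_pred (T : choiceType) (A : {fset T}) (form : T -> R) p :
    (p.-1.-tuple R -> R) -> Prop :=
  match p with
  | 0 => fun phi => phi = (fun _ => 0)
  | q.+1 => fun phi => @logder T A form q phi
  end.

Definition arr_poly (T : choiceType) (A : {fset T}) (form : T -> R) : R :=
  \prod_(X <- A) form X.

End Multiderivations.

Section Quotient.

Variables (K : fieldType) (l : nat) (a : dhomog l K 1).

Definition form_ideal : pred {mpoly K[l]} :=
  fun f => if excluded_middle_informative (rdvd (mpoly_of_dhomog a) f)
           then true else false.

Lemma form_idealP f :
  reflect (rdvd (mpoly_of_dhomog a) f) (f \in form_ideal).
Proof.
by rewrite unfold_in /form_ideal; case: excluded_middle_informative => h;
  constructor.
Qed.

Lemma form_idealr_closed : idealr_closed form_ideal.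
Proof.
split.
- by apply/form_idealP; exists 0; rewrite mul0r.
- apply/form_idealP => -[c] /(congr1 (mcoeff 0%MM)).
  rewrite mcoeff1 eqxx rmorphM /=.
  rewrite (dhomog_nemf_coeff (dhomog_is_dhomog a)) ?mf0 //.
  by rewrite mulr0 => /eqP; rewrite oner_eq0.
- move=> b f g /form_idealP[c ->] /form_idealP[d ->]; apply/form_idealP.
  by exists (b * c + d); rewrite mulrDl mulrA.
Qed.

HB.instance Definition _ :=
  isIdealr.Build {mpoly K[l]} form_ideal form_idealr_closed.

Definition form_idealr : idealr {mpoly K[l]} := form_ideal.

Definition Sbar := {ideal_quot form_idealr}.

HB.instance Definition _ := GRing.ComNzRing.on Sbar.

Definition bar (f : {mpoly K[l]}) : Sbar := \pi_Sbar f.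

Definition sect (g : Sbar) : {mpoly K[l]} := repr g.

Lemma sectK : cancel sect bar. Proof. exact: reprK. Qed.

Lemma barB : zmod_morphism bar.
Proof. exact: (@pi_is_zmod_morphism _ _ _ {ideal_quot form_idealr}). Qed.

HB.instance Definition _ :=
  GRing.isZmodMorphism.Build {mpoly K[l]} Sbar bar barB.

Lemma barM : monoid_morphism bar.
Proof. by split=> [|f g]; rewrite /bar !piE. Qed.

HB.instance Definition _ :=
  GRing.isMonoidMorphism.Build {mpoly K[l]} Sbar bar barM.

Lemma bar_eqP f g :
  bar f = bar g <-> rdvd (mpoly_of_dhomog a) (f - g).
Proof.
split=> [/eqP|h]; last first.
  by apply/eqP; rewrite /bar -Quotient.idealrBE; apply/form_idealP.
by rewrite /bar -Quotient.idealrBE => /form_idealP.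
Qed.

Definition Sbar_scale (c : K) (g : Sbar) : Sbar := bar c%:MP * g.

Lemma Sbar_scaleA b c g :
  Sbar_scale b (Sbar_scale c g) = Sbar_scale (b * c) g.
Proof. by rewrite /Sbar_scale mulrA -rmorphM -mpolyCM. Qed.

Lemma Sbar_scale1 : left_id 1 Sbar_scale.
Proof. by move=> g; rewrite /Sbar_scale mpolyC1 rmorph1 mul1r. Qed.

Lemma Sbar_scaleDr : right_distributive Sbar_scale +%R.
Proof. by move=> c g h; rewrite /Sbar_scale mulrDr. Qed.

Lemma Sbar_scaleDl g : {morph Sbar_scale^~ g : b c / b + c}.
Proof. by move=> b c; rewrite /Sbar_scale mpolyCD rmorphD mulrDl. Qed.

HB.instance Definition _ := GRing.Zmodule_isLmodule.Build K Sbar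
  Sbar_scaleA Sbar_scale1 Sbar_scaleDr Sbar_scaleDl.

Lemma Sbar_scaleAl (c : K) (g h : Sbar) : c *: (g * h) = c *: g * h.
Proof. exact: mulrA. Qed.

HB.instance Definition _ := GRing.Lmodule_isLalgebra.Build K Sbar Sbar_scaleAl.
HB.instance Definition _ := GRing.Lalgebra_isComAlgebra.Build K Sbar.

Lemma barZ : scalable bar.
Proof. by move=> c f; rewrite -mul_mpolyC rmorphM. Qed.

HB.instance Definition _ :=
  GRing.isScalable.Build K {mpoly K[l]} Sbar *:%R bar barZ.

End Quotient.

Section Arrangements.

Variables (K : fieldType) (l : nat).

Local Notation V := 'rV[K]_l.

Definition is_hyperplane (U : {vspace V}) : Prop := (\dim U).+1 = l.

Definition is_arrangement (A : {fset {vspace V}}) : Prop :=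
  forall U, U \in A -> is_hyperplane U.

Definition form_at (a : dhomog l K 1) (v : V) : K :=
  (mpoly_of_dhomog a).@[fun i => v 0 i].

Definition is_form_of (U : {vspace V}) (a : dhomog l K 1) : Prop :=
  forall v : V, v \in U <-> form_at a v = 0.

(* Linear forms on H are the restrictions of linear forms on V, i.e. the
   images in Sbar of the elements of degree 1. *)
Definition is_form_in (H : {vspace V}) (aH : dhomog l K 1)
    (X : {vspace V}) (b : Sbar aH) : Prop :=
  exists2 a : dhomog l K 1, b = bar aH (mpoly_of_dhomog a) &
    forall v : V, v \in H -> (v \in X <-> form_at a v = 0).

Definition restriction (A' : {fset {vspace V}}) (H : {vspace V}) :
    {fset {vspace V}} :=
  [fset (L :&: H)%VS | L in A'].

(* The quotient is chosen as any solution of Q(A^H) B = bar Q(A'); it exists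
   (Bbar_spec) and is unique, Sbar being a domain. *)
Definition Bbar (A : {fset {vspace V}}) (H : {vspace V})
    (alpha : {vspace V} -> dhomog l K 1)
    (beta : {vspace V} -> Sbar (alpha H)) : Sbar (alpha H) :=
  let A' := A `\ H in
  epsilon (inhabits 0) (fun B =>
    arr_poly (restriction A' H) beta * B
    = bar (alpha H) (arr_poly A' (fun L => mpoly_of_dhomog (alpha L)))).

(* Computed on representatives; dbarE shows that any lifts give the same
   value. *)
Definition dbar (a : dhomog l K 1) p :
    (p.-tuple {mpoly K[l]} -> {mpoly K[l]}) ->
    p.-1.-tuple (Sbar a) -> Sbar a :=
  match p with
  | 0 => fun _ _ => 0
  | q.+1 => fun theta g =>
      bar a (theta [tuple of mpoly_of_dhomog a :: map (@sect K l a) g])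
  end.

End Arrangements.

Section DbarWellDefined.

Variables (K : fieldType) (l : nat) (a : dhomog l K 1).
Local Notation S := {mpoly K[l]}.

Lemma tsubst_id (R : comAlgType K) p (f : p.-tuple R) i :
  tsubst f i (tnth f i) = f.
Proof. by apply: eq_from_tnth => j; rewrite tnth_mktuple; case: eqP => [->|]. Qed.

Lemma multider_bar q (theta : q.+1.-tuple S -> S) (f : q.-tuple S)
    (i : 'I_q) (g : S) :
  is_multider theta -> bar a g = bar a (tnth f i) ->
  bar a (theta [tuple of mpoly_of_dhomog a :: tsubst f i g])
  = bar a (theta [tuple of mpoly_of_dhomog a :: f]).
Proof.
move=> [der alt] /bar_eqP[c eqg].
set h := [tuple of mpoly_of_dhomog a :: f]; set j := lift ord0 i.
have E g' : [tuple of mpoly_of_dhomog a :: tsubst f i g'] = tsubst h j g'.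
  apply: eq_from_tnth => k; rewrite tnth_mktuple.
  case: (unliftP ord0 k) => [k'|] ->; last by rewrite !tnth0.
  by rewrite /h !tnthS tnth_mktuple (inj_eq lift_inj).
have [lin leib] := der h j.
rewrite E -[g](subrK (tnth f i)) eqg.
have -> : theta (tsubst h j (c * mpoly_of_dhomog a + tnth f i)) =
  theta (tsubst h j (c * mpoly_of_dhomog a)) + theta (tsubst h j (tnth f i)).
  by have := lin 1 (c * mpoly_of_dhomog a) (tnth f i); rewrite !scale1r.
rewrite -(E (tnth f i)) tsubst_id leib.
have -> : theta (tsubst h j (mpoly_of_dhomog a)) = 0.
  by apply: (alt _ ord0 j) => //; rewrite !tnth_mktuple eqxx.
rewrite mulr0 add0r rmorphD rmorphM /=.
have -> : bar a (mpoly_of_dhomog a) = 0.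
  by rewrite -(rmorph0 (bar a)); apply/bar_eqP; exists 1; rewrite subr0 mul1r.
by rewrite mul0r add0r.
Qed.

Lemma dbarE q (theta : q.+1.-tuple S -> S) (f : q.-tuple S) :
  is_multider theta ->
  dbar theta [tuple of map (bar a) f]
  = bar a (theta [tuple of mpoly_of_dhomog a :: f]).
Proof.
move=> mt /=; pose f' := [tuple of map (@sect K l a) [tuple of map (bar a) f]].
have f'P i : bar a (tnth f' i) = bar a (tnth f i).
  by rewrite !tnth_map sectK.
pose h k := [tuple if (j < k)%N then tnth f' j else tnth f j | j < q].
transitivity (bar a (theta [tuple of mpoly_of_dhomog a :: h q])).
  have -> : h q = f' by apply: eq_from_tnth => i; rewrite tnth_mktuple ltn_ord.
  by congr (bar a (theta _)); apply: val_inj.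
have h0 : h 0%N = f by apply: eq_from_tnth => i; rewrite tnth_mktuple.
suff: forall k, (k <= q)%N ->
    bar a (theta [tuple of mpoly_of_dhomog a :: h k])
    = bar a (theta [tuple of mpoly_of_dhomog a :: f]) by apply.
elim=> [|k IHk] ltkq; first by rewrite h0.
rewrite -IHk 1?ltnW //.
have -> : h k.+1 = tsubst (h k) (Ordinal ltkq) (tnth f' (Ordinal ltkq)).
  apply: eq_from_tnth => j; rewrite !tnth_mktuple.
  rewrite ltnS leq_eqVlt -(inj_eq val_inj) /=.
  by case: eqVneq => // e; congr (tnth _ _); apply: val_inj.
by apply: multider_bar => //; rewrite f'P tnth_mktuple ltnn.
Qed.

End DbarWellDefined.

Section LinearForms.

Variables (K : fieldType) (l : nat).
Local Notation V := 'rV[K]_l.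
Implicit Types (a b : dhomog l K 1) (v : V).

Lemma linformE a :
  mpoly_of_dhomog a = \sum_(i < l) (mpoly_of_dhomog a)@_U_(i) *: 'X_i.
Proof.
apply/mpolyP => m; rewrite linear_sum /=.
under eq_bigr do rewrite mcoeffZ mcoeffX.
have [/mdeg1P[i /eqP ->]|ne1] := boolP (mdeg m == 1%N).
  rewrite (bigD1 i) //= eqxx mulr1 big1 ?addr0 // => j ji.
  by rewrite eq_mnm1 (negPf ji) mulr0.
rewrite (dhomog_nemf_coeff (dhomog_is_dhomog a)) // big1 // => i _.
have /negPf -> : U_(i)%MM != m; last by rewrite mulr0.
by apply: contraNneq ne1 => <-; rewrite mdeg1.
Qed.

Lemma form_atE a v :
  form_at a v = \sum_(i < l) (mpoly_of_dhomog a)@_U_(i) * v 0 i.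
Proof.
rewrite /form_at {1}linformE raddf_sum /=; apply: eq_bigr => i _.
by rewrite mevalZ mevalXU.
Qed.

Lemma form_atP a c v w : form_at a (c *: v + w) = c * form_at a v + form_at a w.
Proof.
rewrite !form_atE mulr_sumr -big_split; apply: eq_bigr => i _ /=.
by rewrite !mxE; ring.
Qed.

Lemma form_at_lin a b c v : form_at (c *: a + b) v = c * form_at a v + form_at b v.
Proof. by rewrite /form_at mevalD mevalZ. Qed.

Lemma form_at_eq0 a : (forall v, form_at a v = 0) -> mpoly_of_dhomog a = 0.
Proof.
move=> a0; rewrite linformE big1 // => i _.
have := a0 (delta_mx 0 i); rewrite form_atE (bigD1 i) //= mxE !eqxx mulr1.
rewrite big1 ?addr0 => [->|j ji]; first by rewrite scale0r.
by rewrite mxE (negPf ji) mulr0.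
Qed.

Lemma form_at_ker a b : (forall v, form_at a v = 0 -> form_at b v = 0) ->
  rdvd (mpoly_of_dhomog a) (mpoly_of_dhomog b).
Proof.
move=> ker; have [a0|] := classic (forall v, form_at a v = 0).
  by exists 0; rewrite mul0r; apply: form_at_eq0 => v; apply: ker.
move=> /not_all_ex_not[u /eqP au].
exists (form_at b u / form_at a u)%:MP.
have /form_at_eq0 : forall v,
    form_at (- (form_at b u / form_at a u) *: a + b) v = 0.
  move=> v; rewrite form_at_lin.
  have /ker : form_at a (- (form_at a v / form_at a u) *: u + v) = 0.
    by rewrite form_atP mulNr divfK // addNr.
  rewrite form_atP => /eqP; rewrite addr_eq0 mulNr eqr_opp => /eqP h.
  by apply/eqP; rewrite addr_eq0 mulNr eqr_opp -h; apply/eqP; ring.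
move=> /eqP; rewrite /= addrC scaleNr subr_eq0 => /eqP ->.
by rewrite mul_mpolyC.
Qed.

Lemma bar_form_eq (H : {vspace V}) aH a b :
  is_form_of H aH ->
  (forall v, v \in H -> form_at a v = 0 -> form_at b v = 0) ->
  rdvd (bar aH (mpoly_of_dhomog a)) (bar aH (mpoly_of_dhomog b)).
Proof.
move=> HP ker.
have bar0 c : (forall v, v \in H -> form_at c v = 0) ->
    bar aH (mpoly_of_dhomog c) = 0.
  move=> c0; rewrite -(rmorph0 (bar aH)); apply/bar_eqP; rewrite subr0.
  by apply: form_at_ker => v /HP /c0.
have [a0|] := classic (forall v, v \in H -> form_at a v = 0).
  by exists 0; rewrite mul0r; apply: bar0 => v vH; apply: ker => //; apply: a0.
move=> /not_all_ex_not[u nu]; have [uH /eqP au] := imply_to_and _ _ nu.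
exists (form_at b u / form_at a u)%:A.
have /bar0 : forall v, v \in H ->
    form_at (- (form_at b u / form_at a u) *: a + b) v = 0.
  move=> v vH; rewrite form_at_lin.
  have vuH : - (form_at a v / form_at a u) *: u + v \in H.
    by rewrite memvD ?memvZ.
  have /(ker _ vuH) : form_at a (- (form_at a v / form_at a u) *: u + v) = 0.
    by rewrite form_atP mulNr divfK // addNr.
  rewrite form_atP => /eqP; rewrite addr_eq0 mulNr eqr_opp => /eqP h.
  by apply/eqP; rewrite addr_eq0 mulNr eqr_opp -h; apply/eqP; ring.
rewrite /= raddfD /= linearZ /= scaleNr addrC => /eqP.
by rewrite subr_eq0 => /eqP ->; rewrite -scalerAl mul1r.
Qed.

Lemma rdvd_prod (R : comNzRingType) (I : eqType) (r : seq I) (F G : I -> R) :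
  (forall i, i \in r -> rdvd (F i) (G i)) ->
  rdvd (\prod_(i <- r) F i) (\prod_(i <- r) G i).
Proof.
elim: r => [|i r IH] h; first by exists 1; rewrite !big_nil mul1r.
have [c Ec] := h i (mem_head _ _).
have [|d Ed] := IH; first by move=> j jr; apply: h; rewrite inE jr orbT.
by exists (c * d); rewrite !big_cons Ec Ed; ring.
Qed.

Lemma Bbar_spec (A : {fset {vspace V}}) (H : {vspace V})
    (alpha : {vspace V} -> dhomog l K 1)
    (beta : {vspace V} -> Sbar (alpha H)) :
  H \in A -> (forall L, L \in A -> is_form_of L (alpha L)) ->
  (forall X, X \in restriction (A `\ H) H -> is_form_in H X (beta X)) ->
  arr_poly (restriction (A `\ H) H) beta * Bbar A beta
  = bar (alpha H) (arr_poly (A `\ H) (fun L => mpoly_of_dhomog (alpha L))).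
Proof.
move=> HA alphaP betaP; apply: (epsilon_spec (inhabits 0)
  (fun B => arr_poly (restriction (A `\ H) H) beta * B = _)).
suff [B EB] : rdvd (arr_poly (restriction (A `\ H) H) beta)
  (bar (alpha H) (arr_poly (A `\ H) (fun L => mpoly_of_dhomog (alpha L)))).
  by exists B; rewrite mulrC.
rewrite /arr_poly rmorph_prod /=.
rewrite [X in rdvd _ X](@partition_big_imfset _ _ _ _ _ (fun L => (L :&: H)%VS)) /=.
rewrite -/(restriction _ _).
apply: (rdvd_prod (F := beta)) => X XR; have [a -> aP] := betaP X XR.
have /imfsetP[/= L LA' EX] := XR.
have LA : L \in A by move: LA'; rewrite !inE => /andP[].
have [|c Ec] := @bar_form_eq H (alpha H) a (alpha L) (alphaP H HA).
  move=> v vH /(aP v vH); rewrite EX memv_cap => /andP[vL _].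
  by apply/(alphaP L LA).
rewrite big_mkcond (big_fsetD1 L) //= -EX eqxx Ec.
by set P := \big[_/_]_(_ <- _) _; exists (c * P); ring.
Qed.

End LinearForms.

(* Exactness of 0 -> M -f-> N -g-> P at M and N, for additive maps between
   subgroups M, N of X, Y. *)
Definition left_exact (X Y Z : Type) (z : Z) (M : X -> Prop) (N : Y -> Prop)
    (f : X -> Y) (g : Y -> Z) : Prop :=
  (forall x1 x2, M x1 -> M x2 -> f x1 = f x2 -> x1 = x2) /\
  (forall y, N y -> (g y = z <-> exists2 x, M x & f x = y)).

(* Main.v *)
(** Write x for the form of H and fix X in the restriction, with b a lift of its
    form. Each L over X (that is, with L cap H = X) has a form y_L such that b is a
    combination of y_L and x. If theta is logarithmic along A', then
    x theta(b, f) - b theta(x, f) is divisible by every such y_L, hence by their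
    product; modulo x, the product Q_X of the restricted y_L divides
    b theta(x, f). Similarly theta(x, b, f) = - theta(b, x, f) is divisible by
    Q_X modulo x. The Q_X are pairwise coprime with product Q(A^H) B, so B divides
    the boundary of theta, and the quotient is logarithmic along A^H. Primality of
    linear forms, in the polynomial ring and in its quotient by x, comes from the
    substitution z_i -> z_i - u_i a with a(u) = 1, an endomorphism of the
    polynomial ring with kernel (a). *)

Require Import Defs.
From mathcomp Require Import all_boot all_algebra finmap mpoly.
From mathcomp Require Import ring zify.
From Stdlib Require Import ClassicalEpsilon FunctionalExtensionality.

Set Implicit Arguments.
Unset Strict Implicit.
Unset Printing Implicit Defensive.

Import GRing.Theory.
Local Open Scope fset_scope.
Local Open Scope ring_scope.

(** * Coprimality in a commutative ring *)

Section Divisibility.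

Variable R : comNzRingType.
Implicit Types a b c g q : R.

Definition euclid_property q :=
  forall f g, rdvd q (f * g) -> rdvd q f \/ rdvd q g.

(** Equivalently, [b] is a nonzerodivisor modulo [a]. The relation is not symmetric in a general
    ring, so products on the two sides are treated separately. *)
Definition coprime_elts a b := forall g, rdvd a (b * g) -> rdvd a g.

Lemma rdvd_trans a b c : rdvd a b -> rdvd b c -> rdvd a c.
Proof. by move=> [d ->] [e ->]; exists (e * d); rewrite mulrA. Qed.

Lemma rdvd_mull a b c : rdvd a c -> rdvd a (b * c).
Proof. by move=> [d ->]; exists (b * d); rewrite mulrA. Qed.

Lemma rdvd_mulr a b c : rdvd a b -> rdvd a (b * c).
Proof. by rewrite mulrC; apply: rdvd_mull. Qed.

Lemma rdvd_refl a : rdvd a a.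
Proof. by exists 1; rewrite mul1r. Qed.

Lemma rdvd_cancel a b c : GRing.lreg a -> rdvd (a * b) (a * c) -> rdvd b c.
Proof. by move=> rega [d E]; exists d; apply: rega; rewrite E; ring. Qed.

Lemma prime_coprime q a : euclid_property q -> ~ rdvd q a -> coprime_elts q a.
Proof. by move=> pq nqa g /pq[]. Qed.

Lemma coprime_prodr (I : eqType) (r : seq I) (F : I -> R) a :
  (forall i, i \in r -> coprime_elts a (F i)) ->
  coprime_elts a (\prod_(i <- r) F i).
Proof.
elim: r => [|i r IH] cop g; first by rewrite big_nil mul1r.
rewrite big_cons -mulrA => /(cop i (mem_head _ _)).
by apply: IH => j jr; apply: cop; rewrite inE jr orbT.
Qed.

(** Each factor in turn divides [g] and is cancelled before the next one is treated; regularity of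
    the factors permits the cancellation. *)
Lemma coprime_prodl (I : eqType) (r : seq I) (F : I -> R) b :
  (forall i, i \in r -> GRing.lreg (F i) /\ coprime_elts (F i) b) ->
  coprime_elts (\prod_(i <- r) F i) b.
Proof.
elim: r => [|i r IH] cop g; first by exists g; rewrite big_nil mulr1.
have [regi copi] := cop i (mem_head _ _).
rewrite big_cons => dvd.
have [g' Eg] : rdvd (F i) g.
  by apply: copi; apply: rdvd_trans dvd; apply: rdvd_mulr; apply: rdvd_refl.
have copr : coprime_elts (\prod_(j <- r) F j) b.
  by apply: IH => j jr; apply: cop; rewrite inE jr orbT.
suff /copr[d Ed] : rdvd (\prod_(j <- r) F j) (b * g').
  by exists d; rewrite Eg Ed; ring.
apply: rdvd_cancel regi _.
by have -> : F i * (b * g') = b * g by rewrite Eg; ring.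
Qed.

(** Write [g] as a multiple of the product of the later factors; coprimality passes divisibility by
    the first factor on to the cofactor. *)
Lemma rdvd_prod_coprime (I : eqType) (r : seq I) (F : I -> R) g :
  uniq r -> {in r &, forall i j, i != j -> coprime_elts (F i) (F j)} ->
  (forall i, i \in r -> rdvd (F i) g) -> rdvd (\prod_(i <- r) F i) g.
Proof.
elim: r => [|i r IH] /=; first by exists g; rewrite big_nil mulr1.
move=> /andP[nir ur] cop dvd; rewrite big_cons.
have [||d Ed] := IH ur.
- by move=> j k jr kr; apply: cop; rewrite inE ?jr ?kr orbT.
- by move=> j jr; apply: dvd; rewrite inE jr orbT.
have := dvd i (mem_head _ _); rewrite Ed mulrC => /coprime_prodr[j jr|e ->].
  apply: cop; rewrite ?mem_head // ?inE ?jr ?orbT //.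
  by apply: contraNneq nir => ->.
by exists e; ring.
Qed.

Lemma lreg_prod (I : eqType) (r : seq I) (F : I -> R) :
  (forall i, i \in r -> GRing.lreg (F i)) -> GRing.lreg (\prod_(i <- r) F i).
Proof.
by move=> reg; rewrite big_seq; apply: (big_ind (@GRing.lreg R));
  [apply: lreg1 | apply: lregM | apply: reg].
Qed.

Lemma lreg_mulr a b : GRing.lreg (a * b) -> GRing.lreg b.
Proof. by move=> reg c d /= E; apply: reg; rewrite -!mulrA E. Qed.

End Divisibility.

(** * Linear forms are prime *)

Section LinearForms.

Variables (K : fieldType) (l : nat).
Local Notation V := 'rV[K]_l.
Local Notation S := {mpoly K[l]}.
Implicit Types (a b : dhomog l K 1) (u v : V).

Lemma form_at_rdvd a b v :
  rdvd (mpoly_of_dhomog a) (mpoly_of_dhomog b) ->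
  form_at a v = 0 -> form_at b v = 0.
Proof. by move=> [c E] av; rewrite /form_at E rmorphM /= [X in _ * X]av mulr0. Qed.

Lemma form_at_rdvd_bar aH a b v :
  rdvd (bar aH (mpoly_of_dhomog a)) (bar aH (mpoly_of_dhomog b)) ->
  form_at aH v = 0 -> form_at a v = 0 -> form_at b v = 0.
Proof.
move=> [c]; rewrite -[c]sectK -rmorphM => /bar_eqP[d E] Hv av.
have {E} E : mpoly_of_dhomog b =
    sect c * mpoly_of_dhomog a + d * mpoly_of_dhomog aH.
  by rewrite -E addrC subrK.
rewrite /form_at E rmorphD !rmorphM /=.
by rewrite [X in _ * X + _]av [X in _ + _ * X]Hv !mulr0 addr0.
Qed.

Lemma form_at_ker_scalar a b u : form_at a u != 0 ->
  (forall v, form_at a v = 0 -> form_at b v = 0) ->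
  b = (form_at b u / form_at a u) *: a.
Proof.
move=> au ker; apply/eqP; rewrite -subr_eq0 addrC -scaleNr; apply/eqP.
apply: val_inj; apply: form_at_eq0 => v; rewrite form_at_lin.
(* Subtracting a multiple of [u] moves [v] into the kernel of [a], where [b] vanishes. *)
have /ker : form_at a (- (form_at a v / form_at a u) *: u + v) = 0.
  by rewrite form_atP mulNr divfK // addNr.
by rewrite form_atP => /(canRL (addKr _)) ->; ring.
Qed.

(* The substitution attached to the projection of V onto the kernel of [a]
   along [u], when a(u) = 1. *)
Definition proj_along a u (f : S) : S :=
  f \mPo [tuple 'X_i - u 0 i *: mpoly_of_dhomog a | i < l].

(** On linear forms the substitution is composition with v -> v - a(v) u. *)
Lemma proj_along_form a u b :
  proj_along a u (mpoly_of_dhomog b) = mpoly_of_dhomog (b - form_at b u *: a).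
Proof.
rewrite /proj_along (linformE b) raddf_sum /=.
under eq_bigr do rewrite comp_mpolyZ comp_mpolyXU -tnth_nth tnth_mktuple
  scalerBr scalerA.
by rewrite sumrB -scaler_suml -linformE -form_atE.
Qed.

(** Every variable changes by a multiple of [a], so modulo [a] nothing changes. *)
Lemma bar_proj_along a u f : bar a (proj_along a u f) = bar a f.
Proof.
have bara : bar a (mpoly_of_dhomog a) = 0.
  by rewrite -(rmorph0 (bar a)); apply/bar_eqP; exists 1; rewrite subr0 mul1r.
rewrite /proj_along comp_mpolyEX [in RHS](mpolyE f) !raddf_sum /=.
apply: eq_bigr => m _; rewrite !linearZ comp_mpolyX mpolyXE_id /=.
congr (_ *: _); rewrite !rmorph_prod /=; apply: eq_bigr => i _.
by rewrite !rmorphXn tnth_mktuple rmorphB /= linearZ /= bara scaler0 subr0.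
Qed.

Lemma proj_along_eq0 a u f : form_at a u = 1 ->
  (proj_along a u f = 0 <-> rdvd (mpoly_of_dhomog a) f).
Proof.
move=> au; split=> [f0|[c ->]].
  rewrite -[f]subr0; apply/bar_eqP.
  by rewrite -(bar_proj_along a u) f0 rmorph0.
rewrite /proj_along rmorphM /= -/(proj_along a u (mpoly_of_dhomog a)).
by rewrite proj_along_form au scale1r subrr mulr0.
Qed.

Lemma form_normalize a u : form_at a u != 0 -> exists u, form_at a u = 1.
Proof.
move=> au; exists ((form_at a u)^-1 *: u).
have := form_atP a (form_at a u)^-1 u 0; rewrite addr0 mulVf // => ->.
by rewrite form_atE big1 ?addr0 // => i _; rewrite mxE mulr0.
Qed.

(** The substitution is a ring endomorphism with kernel (a), so the quotient by [a] embeds in the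
    polynomial ring, a domain. *)
Lemma form_prime a u : form_at a u != 0 -> euclid_property (mpoly_of_dhomog a).
Proof.
move=> /form_normalize[w aw] f g /(proj_along_eq0 _ aw).
rewrite /proj_along rmorphM => /eqP; rewrite mulf_eq0.
by case/orP=> /eqP /(proj_along_eq0 _ aw); [left|right].
Qed.

Lemma bar_form_prime aH u a v : form_at aH u != 0 ->
  form_at aH v = 0 -> form_at a v != 0 ->
  euclid_property (bar aH (mpoly_of_dhomog a)).
Proof.
move=> /form_normalize[w Hw] Hv av.
(* [a'] is the image of [a] under the projection along [w]. Divisibility by [a] modulo [aH] becomes
   divisibility by [a'] among polynomials, where [form_prime] applies. *)
set a' := a - form_at a w *: aH.
have a'v : form_at a' v != 0.
  by rewrite /a' addrC -scaleNr form_at_lin Hv mulr0 add0r.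
have dvdE f : rdvd (bar aH (mpoly_of_dhomog a)) (bar aH f) <->
    rdvd (mpoly_of_dhomog a') (proj_along aH w f).
  split=> [[c]|[c E]].
    rewrite -[c]sectK -rmorphM => /bar_eqP /(proj_along_eq0 _ Hw) /eqP.
    rewrite /proj_along rmorphB rmorphM /= subr_eq0 => /eqP ->.
    rewrite -/(proj_along aH w (mpoly_of_dhomog a)) proj_along_form.
    by apply: rdvd_mull; apply: rdvd_refl.
  rewrite -(bar_proj_along aH w f) E -proj_along_form rmorphM /= bar_proj_along.
  by apply: rdvd_mull; apply: rdvd_refl.
move=> f g; rewrite -[f]sectK -[g]sectK -rmorphM => /dvdE.
by rewrite /proj_along rmorphM => /(form_prime a'v)[] ?; [left|right]; apply/dvdE.
Qed.

(** If [aH] divides a (f - g), then, being prime, it divides f - g: it cannot divide [a], which is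
    nonzero at a zero of [aH]. *)
Lemma bar_form_lreg aH u a v : form_at aH u != 0 ->
  form_at aH v = 0 -> form_at a v != 0 ->
  GRing.lreg (bar aH (mpoly_of_dhomog a)).
Proof.
move=> Hu Hv av f g; rewrite -[f]sectK -[g]sectK -!rmorphM /= => /bar_eqP.
rewrite -mulrBr => /(form_prime Hu)[/form_at_rdvd/(_ Hv)/eqP|/bar_eqP //].
by rewrite (negPf av).
Qed.

End LinearForms.

(** * Multiderivations *)

Section MultiderCons.

Variables (K : fieldType) (R : comAlgType K).

Lemma derivation_lin (D : R -> R) (c d : K) x y : is_derivation D ->
  D (c *: x + d *: y) = c *: D x + d *: D y.
Proof.
move=> [lin _]; have D0 : D 0 = 0.
  by have := lin 1 0 0; rewrite !scale1r addr0 -[LHS]addr0 => /addrI <-.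
by rewrite lin -[d *: y]addr0 lin D0 addr0.
Qed.

Lemma multider_der0 q (theta : q.+1.-tuple R -> R) (f : q.-tuple R) :
  is_multider theta -> is_derivation (fun g => theta [tuple of g :: f]).
Proof.
(* The entry 0 is a placeholder that [tsubst] overwrites. *)
move=> [der _]; have := der [tuple of 0 :: f] ord0.
suff E g : tsubst [tuple of 0 :: f] ord0 g = [tuple of g :: f].
  by case=> lin leib; split=> [c x y|x y];
    [have := lin c x y | have := leib x y]; rewrite !E.
apply: eq_from_tnth => k; rewrite tnth_mktuple.
by case: (unliftP ord0 k) => [k'|] -> //=; rewrite !tnthS.
Qed.

Lemma multider_der1 q (theta : q.+2.-tuple R -> R) x (f : q.-tuple R) :
  is_multider theta ->
  is_derivation (fun g => theta [tuple of x :: [tuple of g :: f]]).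
Proof.
move=> [der _]; have := der [tuple of x :: [tuple of 0 :: f]] (lift ord0 ord0).
suff E g : tsubst [tuple of x :: [tuple of 0 :: f]] (lift ord0 ord0) g
    = [tuple of x :: [tuple of g :: f]].
  by case=> lin leib; split=> [c y z|y z];
    [have := lin c y z | have := leib y z]; rewrite !E.
apply: eq_from_tnth => k; rewrite tnth_mktuple.
case: (unliftP ord0 k) => [k'|] -> //=.
rewrite (inj_eq lift_inj) !tnthS.
by case: (unliftP ord0 k') => [k''|] -> //=; rewrite !tnthS.
Qed.

Lemma multider_alt01 q (theta : q.+2.-tuple R -> R) x (f : q.-tuple R) :
  is_multider theta -> theta [tuple of x :: [tuple of x :: f]] = 0.
Proof. by move=> [_ alt]; apply: (alt _ ord0 (lift ord0 ord0)). Qed.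

Lemma multider_swap01 q (theta : q.+2.-tuple R -> R) x y (f : q.-tuple R) :
  is_multider theta ->
  theta [tuple of x :: [tuple of y :: f]]
  = - theta [tuple of y :: [tuple of x :: f]].
Proof.
move=> mt; apply/eqP; rewrite -addr_eq0; apply/eqP.
(* Polarization: expand the vanishing value at (x + y, x + y). The scalars 1 give the sum the shape
   of [derivation_lin]. *)
have := multider_alt01 (1 *: x + 1 *: y) f mt.
rewrite (derivation_lin _ _ _ _ (multider_der0 _ mt)).
rewrite !(derivation_lin _ _ _ _ (multider_der1 _ _ mt)).
by rewrite !multider_alt01 // !scale1r add0r addr0.
Qed.

(* The expression x theta(a, f) - a theta(x, f) is unchanged, up to a scalar,
   when a is replaced by y i = (a - d x) / c. *)
Lemma rdvd_pencil (I : eqType) (r : seq I) (y : I -> R) (a x : R)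
    q (theta : q.+1.-tuple R -> R) (f : q.-tuple R) :
  uniq r -> {in r &, forall i j, i != j -> coprime_elts (y i) (y j)} ->
  (forall i, i \in r -> exists c d : K, a = c *: y i + d *: x) ->
  is_multider theta ->
  (forall i, i \in r -> rdvd (y i) (theta [tuple of y i :: f])) ->
  rdvd (\prod_(i <- r) y i)
    (x * theta [tuple of a :: f] - a * theta [tuple of x :: f]).
Proof.
move=> ur cop pencil mt dvd; apply: rdvd_prod_coprime => // i ir.
have [c [d ->]] := pencil i ir; have [e Ee] := dvd i ir.
rewrite (derivation_lin _ _ _ _ (multider_der0 _ mt)) Ee.
set tx := theta _; exists (c%:A * (x * e - tx)).
rewrite -(mulr_algl c (y i)) -(mulr_algl d x) -(mulr_algl c (e * y i)).
by rewrite -(mulr_algl d tx); ring.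
Qed.

(** With a = c y + d x in the second slot, the x term vanishes by alternation, and a swap brings
    [y i] to the first slot. *)
Lemma rdvd_pencil2 (I : eqType) (r : seq I) (y : I -> R) (a x : R)
    q (theta : q.+2.-tuple R -> R) (f : q.-tuple R) :
  uniq r -> {in r &, forall i j, i != j -> coprime_elts (y i) (y j)} ->
  (forall i, i \in r -> exists c d : K, a = c *: y i + d *: x) ->
  is_multider theta ->
  (forall i, i \in r -> forall g : q.+1.-tuple R,
    rdvd (y i) (theta [tuple of y i :: g])) ->
  rdvd (\prod_(i <- r) y i) (theta [tuple of x :: [tuple of a :: f]]).
Proof.
move=> ur cop pencil mt dvd; apply: rdvd_prod_coprime => // i ir.
have [c [d ->]] := pencil i ir; have [e Ee] := dvd i ir [tuple of x :: f].
rewrite (derivation_lin _ _ _ _ (multider_der1 _ _ mt)) multider_alt01 //.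
rewrite multider_swap01 // Ee; exists (- (c *: e)).
by rewrite scaler0 addr0 scalerN mulNr scalerAl.
Qed.

End MultiderCons.

Lemma dbar_multider (K : fieldType) (l : nat) (a : dhomog l K 1) q
    (theta : q.+1.-tuple {mpoly K[l]} -> {mpoly K[l]}) :
  is_multider theta -> is_multider (@dbar K l a q.+1 theta).
Proof.
move=> mt; split=> [g i|g i j ij gij]; last first.
  have [_ alt] := mt; rewrite /dbar (alt _ (lift ord0 i) (lift ord0 j)).
  - exact: rmorph0.
  - by rewrite (inj_eq lift_inj).
  - by rewrite !tnthS !tnth_map gij.
set h := [tuple of mpoly_of_dhomog a :: [tuple of map (@sect K l a) g]].
(* [dbar] uses the chosen lift of [bar a f], which may differ from [f]; [dbarE] allows [f] itself,
   so the derivation rules can be checked on polynomials. *)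
have E f : dbar theta (tsubst g i (bar a f)) =
    bar a (theta (tsubst h (lift ord0 i) f)).
  set t := tsubst [tuple of map (@sect K l a) g] i f.
  have -> : tsubst g i (bar a f) = [tuple of map (bar a) t].
    apply: eq_from_tnth => j; rewrite [RHS]tnth_map !tnth_mktuple.
    by case: eqP => // _; rewrite [tnth (map_tuple _ _) _]tnth_map sectK.
  rewrite dbarE //; congr (bar a (theta _)).
  apply: eq_from_tnth => k; rewrite tnth_mktuple.
  case: (unliftP ord0 k) => [k'|] -> //=.
  by rewrite !tnthS tnth_mktuple (inj_eq lift_inj).
have [lin leib] := mt.1 h (lift ord0 i).
split=> [c x y|x y]; rewrite -[x]sectK -[y]sectK.
  by rewrite -linearP !E lin linearP.
by rewrite -rmorphM !E leib rmorphD !rmorphM.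
Qed.

(** * The restricted arrangement *)

Section Hyperplanes.

Variables (K : fieldType) (l : nat).
Implicit Types L M H : {vspace 'rV[K]_l}.

Lemma hyperplane_not_sub L M :
  is_hyperplane L -> is_hyperplane M -> L != M -> exists2 v, v \in L & v \notin M.
Proof.
move=> hL hM neq; apply/subvPn; apply: contra neq => sub.
by rewrite eqEdim sub; move: hL hM; rewrite /is_hyperplane; lia.
Qed.

Lemma hyperplane_proper H : is_hyperplane H -> exists v, v \notin H.
Proof.
move=> hH; have /subvPn[v _ nv] : ~~ (fullv <= H)%VS; last by exists v.
apply/negP => /dimvS.
by rewrite dimvf /dim /= mul1n; move: hH; rewrite /is_hyperplane; lia.
Qed.

(** Distinct hyperplanes span the whole space; the dimension formula does the rest. *)
Lemma dim_cap_hyperplanes L H :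
  is_hyperplane L -> is_hyperplane H -> L != H -> (\dim (L :&: H)).+2 = l.
Proof.
move=> hL hH neq; have [v vL nvH] := hyperplane_not_sub hL hH neq.
have ltH : (\dim H < \dim (L + H))%N.
  rewrite ltnNge; apply/negP => le.
  have /eqP E : H == (L + H)%VS by rewrite eqEdim addvSr le.
  by rewrite E (subvP (addvSl L H)) in nvH.
have leV : (\dim (L + H) <= l)%N.
  by have := dimvS (subvf (L + H)); rewrite dimvf /dim /= mul1n.
have := dimv_sum_cap L H; move: hL hH; rewrite /is_hyperplane; lia.
Qed.

Lemma cap_hyperplanes_not_sub H L M :
  is_hyperplane H -> is_hyperplane L -> is_hyperplane M -> L != H -> M != H ->
  (L :&: H != M :&: H)%VS -> exists2 v, v \in (L :&: H)%VS & v \notin (M :&: H)%VS.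
Proof.
move=> hH hL hM LH MH neq; apply/subvPn; apply: contra neq => sub.
rewrite eqEdim sub.
have := dim_cap_hyperplanes hL hH LH; have := dim_cap_hyperplanes hM hH MH; lia.
Qed.

End Hyperplanes.

Section Restriction.

Variables (K : fieldType) (l : nat).
Variables (A : {fset {vspace 'rV[K]_l}}) (H : {vspace 'rV[K]_l}).
Variables (alpha : {vspace 'rV[K]_l} -> dhomog l K 1).
Variables (beta : {vspace 'rV[K]_l} -> Sbar (alpha H)).
Hypotheses (arrA : is_arrangement A) (HA : H \in A).
Hypothesis alphaP : forall L, L \in A -> is_form_of L (alpha L).
Hypothesis betaP :
  forall X, X \in restriction (A `\ H) H -> is_form_in H X (beta X).

Local Notation A' := (A `\ H).
Local Notation AH := (restriction A' H).
Local Notation form L := (mpoly_of_dhomog (alpha L)).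
Local Notation fbar L := (bar (alpha H) (form L)).

Lemma form_at_neq0 L v : L \in A -> (form_at (alpha L) v != 0) = (v \notin L).
Proof.
by move=> LA; congr negb; apply/eqP/idP => /(alphaP LA).
Qed.

Lemma deletionP L : L \in A' -> L \in A /\ L != H.
Proof. by rewrite !inE => /andP[]. Qed.

Lemma coprime_forms L M : L \in A -> M \in A -> L != M ->
  coprime_elts (form L) (form M).
Proof.
move=> LA MA neq.
have [u nu] := hyperplane_proper (arrA LA).
have [v vL vM] := hyperplane_not_sub (arrA LA) (arrA MA) neq.
apply: prime_coprime; first by apply: (form_prime (u := u)); rewrite form_at_neq0.
move=> /form_at_rdvd/(_ ((alphaP LA v).1 vL))/(alphaP MA).
exact/negP.
Qed.

Lemma form_in_alpha L : L \in A -> is_form_in H (L :&: H)%VS (fbar L).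
Proof.
move=> LA; exists (alpha L) => // v vH; rewrite memv_cap vH andbT.
exact: alphaP.
Qed.

(** A point of [H] outside [L] is a point of [H] where a lift of [b] is nonzero; both properties
    follow from it. *)
Lemma form_in_proper X (b : Sbar (alpha H)) : X \in AH -> is_form_in H X b ->
  GRing.lreg b /\ euclid_property b.
Proof.
move=> /imfsetP[L /= LA' ->] [a -> aP].
have [LA neq] := deletionP LA'.
have [u nu] := hyperplane_proper (arrA HA).
have [v vH vL] : exists2 v, v \in H & v \notin L.
  by apply: hyperplane_not_sub (arrA HA) (arrA LA) _; rewrite eq_sym.
have Hu : form_at (alpha H) u != 0 by rewrite form_at_neq0.
have Hv : form_at (alpha H) v = 0 by apply/(alphaP HA).
have av : form_at a v != 0.
  by apply: contra vL => /eqP/(aP v vH); rewrite memv_cap => /andP[].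
by split; [apply: bar_form_lreg Hu Hv av | apply: bar_form_prime Hu Hv av].
Qed.

Lemma coprime_form_in X Y (b c : Sbar (alpha H)) : X \in AH -> Y \in AH -> X != Y ->
  is_form_in H X b -> is_form_in H Y c -> coprime_elts b c.
Proof.
move=> XA YA neq bX cY; apply: prime_coprime.
  by have [] := form_in_proper XA bX.
move: bX cY neq; have /imfsetP[L /= LA' ->] := XA; have /imfsetP[M /= MA' ->] := YA.
move=> [a -> aP] [a' -> aP'] neq.
have [LA LH] := deletionP LA'; have [MA MH] := deletionP MA'.
have [v vL vM] :=
  cap_hyperplanes_not_sub (arrA HA) (arrA LA) (arrA MA) LH MH neq.
have vH : v \in H by move: vL; rewrite memv_cap => /andP[].
move=> /(form_at_rdvd_bar (v := v)) dvd; move/negP: vM; apply.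
by apply/(aP' v vH)/dvd; [apply/(alphaP HA) | apply/(aP v vH)].
Qed.

(** * Grouping the deletion by the traces of its hyperplanes on H *)

Definition fiber X := [seq L <- A' | (L :&: H)%VS == X].

(** The Q_X of the overview. For [X] in the restriction it is, up to a nonzero scalar, a power of
    the form of [X], with exponent the number of hyperplanes over [X]. *)
Definition fiber_poly X : Sbar (alpha H) := \prod_(L <- fiber X) fbar L.

Lemma fiberP X L : L \in fiber X -> L \in A' /\ (L :&: H)%VS = X.
Proof. by rewrite mem_filter => /andP[/eqP]. Qed.

Lemma fiber_uniq X : uniq (fiber X).
Proof. by apply: filter_uniq; apply: fset_uniq. Qed.

Lemma restriction_mem L : L \in A' -> (L :&: H)%VS \in AH.
Proof. exact: in_imfset. Qed.

Lemma bar_arr_poly :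
  bar (alpha H) (arr_poly A' (fun L => form L)) = \prod_(X <- AH) fiber_poly X.
Proof.
rewrite /arr_poly rmorph_prod /=.
rewrite (@partition_big_imfset _ _ _ _ _ (fun L => (L :&: H)%VS)) /=.
by apply: eq_bigr => X _; rewrite /fiber_poly /fiber big_filter.
Qed.

Lemma fiber_poly_lreg X : GRing.lreg (fiber_poly X).
Proof.
apply: lreg_prod => L /fiberP[LA' _]; have [LA _] := deletionP LA'.
by have [] := form_in_proper (restriction_mem LA') (form_in_alpha LA).
Qed.

Lemma coprime_fiber_poly X Y (b : Sbar (alpha H)) :
  X \in AH -> X != Y -> is_form_in H X b -> coprime_elts b (fiber_poly Y).
Proof.
move=> XA neq bX; apply: coprime_prodr => M /fiberP[MA' EM].
have [MA _] := deletionP MA'; have YA := restriction_mem MA'.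
rewrite EM in YA; apply: (coprime_form_in XA YA neq bX).
by rewrite -EM; apply: form_in_alpha.
Qed.

Lemma coprime_fiber_polys X Y : X \in AH -> X != Y ->
  coprime_elts (fiber_poly X) (fiber_poly Y).
Proof.
move=> XA neq; apply: coprime_prodl => L /fiberP[LA' EL].
have [LA _] := deletionP LA'; have := form_in_alpha LA; rewrite EL => LX.
by split; [have [] := form_in_proper XA LX | apply: coprime_fiber_poly LX].
Qed.

Lemma arr_poly_restriction_lreg : GRing.lreg (arr_poly AH beta).
Proof. by apply: lreg_prod => X XA; have [] := form_in_proper XA (betaP XA). Qed.

(** [Bbar] is a factor of the product of the Q_X, which is regular. Its regularity lets identities
    pass from the boundary to its quotient by [Bbar]. *)
Lemma Bbar_lreg : GRing.lreg (Bbar A beta).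
Proof.
apply: (@lreg_mulr _ (arr_poly AH beta)).
rewrite Bbar_spec // bar_arr_poly; apply: lreg_prod => X _.
exact: fiber_poly_lreg.
Qed.

(** Pick w in [H] outside [L]. Since [H] is spanned by [X] and w, a combination of [a] and [alpha L]
    vanishing on [X] and at w vanishes on [H], hence is a multiple of [alpha H]. *)
Lemma fiber_pencil (X L : {vspace 'rV[K]_l}) a :
  (forall v, v \in H -> (v \in X <-> form_at a v = 0)) -> L \in fiber X ->
  exists c d : K, mpoly_of_dhomog a = c *: form L + d *: form H.
Proof.
move=> aP /fiberP[LA' EX]; have [LA neq] := deletionP LA'.
have [u nu] := hyperplane_proper (arrA HA).
have [w wH wL] : exists2 v, v \in H & v \notin L.
  by apply: hyperplane_not_sub (arrA HA) (arrA LA) _; rewrite eq_sym.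
have Lw : form_at (alpha L) w != 0 by rewrite form_at_neq0.
(* This [c] makes a - c [alpha L] vanish at [w]. *)
pose c := form_at a w / form_at (alpha L) w.
have ker v : form_at (alpha H) v = 0 -> form_at (- c *: alpha L + a) v = 0.
  move=> /(alphaP HA) vH; rewrite form_at_lin.
  pose z := - (form_at (alpha L) v / form_at (alpha L) w) *: w + v.
  have zH : z \in H by rewrite memvD ?memvZ.
  have zX : z \in X.
    rewrite -EX memv_cap zH andbT; apply/(alphaP LA).
    by rewrite form_atP mulNr divfK // addNr.
  have /(aP z zH) := zX; rewrite form_atP => /(canRL (addKr _)) ->.
  by rewrite /c; ring.
have Hu : form_at (alpha H) u != 0 by rewrite form_at_neq0.
have := form_at_ker_scalar Hu ker; set d := _ / _ => E.
exists c, d; have <- : c *: alpha L + d *: alpha H = a => //.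
by rewrite -E addrA scaleNr subrr add0r.
Qed.

(** * Divisibility of the boundary by B, and of the quotient by the forms of the restriction *)

Section Boundary.

Variables (q : nat) (theta : q.+1.-tuple {mpoly K[l]} -> {mpoly K[l]}).
Hypothesis thetaP : logder A' (fun L => form L) theta.

Let mt : is_multider theta := thetaP.1.

Lemma coprime_fiber X : {in fiber X &, forall L M,
  L != M -> coprime_elts (form L) (form M)}.
Proof.
move=> L M /fiberP[/deletionP[LA _] _] /fiberP[/deletionP[MA _] _].
exact: coprime_forms.
Qed.

Lemma bar_formH : fbar H = 0.
Proof.
by rewrite -(rmorph0 (bar _)); apply/bar_eqP; exists 1; rewrite subr0 mul1r.
Qed.

Lemma rdvd_bar f g : rdvd f g -> rdvd (bar (alpha H) f) (bar (alpha H) g).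
Proof. by move=> [c ->]; exists (bar _ c); rewrite rmorphM. Qed.

Lemma fiber_poly_dvd X g : X \in AH ->
  rdvd (fiber_poly X) (beta X * @dbar K l (alpha H) q.+1 theta g).
Proof.
move=> XA; have [a -> aP] := betaP XA.
pose f := [tuple of map (@sect K l (alpha H)) g].
have := rdvd_pencil (f := f) (fiber_uniq X) (@coprime_fiber X)
  (fun L => @fiber_pencil X L a aP) mt.
move=> dvd; have {dvd}/rdvd_bar : rdvd (\prod_(L <- fiber X) form L)
    (form H * theta [tuple of mpoly_of_dhomog a :: f]
     - mpoly_of_dhomog a * theta [tuple of form H :: f]).
  by apply: dvd => L /fiberP[LA' _]; apply: thetaP.2.
(* Modulo [alpha H] only the term of the pencil containing the boundary survives, with a minus
   sign. *)
rewrite rmorph_prod rmorphB !rmorphM /= bar_formH mul0r sub0r.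
move=> [c E]; exists (- c); by rewrite mulNr -E opprK.
Qed.

(** After multiplication by Q(A^H) the divisor becomes the product of the pairwise coprime Q_X. Each
    Q_X divides [beta X] times the boundary, and [beta X] is a factor of Q(A^H). *)
Lemma Bbar_dvd g : rdvd (Bbar A beta) (@dbar K l (alpha H) q.+1 theta g).
Proof.
apply: rdvd_cancel arr_poly_restriction_lreg _.
rewrite Bbar_spec // bar_arr_poly; apply: rdvd_prod_coprime.
- exact: fset_uniq.
- by move=> X Y XA _ neq; apply: coprime_fiber_polys.
move=> X XA; rewrite /arr_poly (big_fsetD1 X) //= mulrAC.
by apply: rdvd_mulr; apply: fiber_poly_dvd.
Qed.

End Boundary.

Lemma fiber_poly_dvd_beta q (theta : q.+2.-tuple {mpoly K[l]} -> {mpoly K[l]})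
    X (g : q.-tuple (Sbar (alpha H))) :
  logder A' (fun L => form L) theta -> X \in AH ->
  rdvd (fiber_poly X) (dbar theta [tuple of beta X :: g]).
Proof.
move=> [mt dvd] XA; have [a -> aP] := betaP XA.
pose f := [tuple of map (@sect K l (alpha H)) g].
(* With the arguments written as images, [dbarE] puts the form [a] itself in the second slot of
   [theta], ready for [rdvd_pencil2]. *)
have -> : [tuple of bar (alpha H) (mpoly_of_dhomog a) :: g] =
    [tuple of map (bar (alpha H)) [tuple of mpoly_of_dhomog a :: f]].
  apply: val_inj => /=; rewrite -map_comp; congr (_ :: _).
  by rewrite (eq_map (g := id)) ?map_id // => h /=; rewrite sectK.
rewrite dbarE //.
have := rdvd_pencil2 f (fiber_uniq X) (@coprime_fiber X)
  (fun L => @fiber_pencil X L a aP) mt.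
move=> h; have {h}/rdvd_bar : rdvd (\prod_(L <- fiber X) form L)
    (theta [tuple of form H :: [tuple of mpoly_of_dhomog a :: f]]).
  by apply: h => L /fiberP[LA' _] f'; apply: dvd.
by rewrite rmorph_prod.
Qed.

(** Multiply the hypothesis by Q(A^H) and cancel Q_X: [beta X] divides [c] times the product of the
    other Q_Y, to which it is coprime. *)
Lemma beta_dvd_quotient X c : X \in AH ->
  rdvd (fiber_poly X) (Bbar A beta * c) -> rdvd (beta X) c.
Proof.
move=> XA dvd.
have Xprod : coprime_elts (beta X) (\prod_(Y <- (AH `\ X)%fset) fiber_poly Y).
  apply: coprime_prodr => Y; rewrite !inE eq_sym => /andP[neq _].
  by apply: coprime_fiber_poly (betaP XA).
apply: Xprod; apply: rdvd_cancel (@fiber_poly_lreg X) _.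
rewrite mulrA -(big_fsetD1 X) //= -bar_arr_poly -(Bbar_spec HA alphaP betaP) -mulrA.
rewrite /arr_poly (big_fsetD1 X) //= mulrAC [X in rdvd X _]mulrC -mulrA.
have [d ->] := dvd; set P := \big[_/_]_(_ <- _) _.
by exists (d * P); ring.
Qed.

End Restriction.

(** * The quotient of the boundary by B, and exactness *)

Lemma multider_div (K : fieldType) (R : comAlgType K) (B : R) q
    (phi : q.-tuple R -> R) :
  GRing.lreg B -> is_multider (fun g => B * phi g) -> is_multider phi.
Proof.
move=> regB [der alt]; split=> [f i|f i j ij fij].
  have [lin leib] := der f i; split=> [c x y|x y]; apply: regB.
    by rewrite /= lin mulrDr scalerAr.
  by rewrite /= leib; ring.
by apply: regB; rewrite /= mulr0; apply: alt fij.
Qed.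

Theorem theorem1p6 (K : fieldType) (l : nat)
    (A : {fset {vspace 'rV[K]_l}}) (H : {vspace 'rV[K]_l})
    (alpha : {vspace 'rV[K]_l} -> dhomog l K 1)
    (beta : {vspace 'rV[K]_l} -> Sbar (alpha H)) (p : nat)
    (arrA : is_arrangement A) (HA : H \in A)
    (alphaP : forall L, L \in A -> is_form_of L (alpha L))
    (betaP : forall X, X \in restriction (A `\ H) H ->
               is_form_in H X (beta X))
    (le_pl : (p <= l)%N) :
  let form := fun L => mpoly_of_dhomog (alpha L) in
  let A' := A `\ H in
  let D := @logder K {mpoly K[l]} _ A form p in
  let D' := @logder K {mpoly K[l]} _ A' form p in
  let DHB := fun psi : p.-1.-tuple (Sbar (alpha H)) -> Sbar (alpha H) =>
    exists2 phi, @logder_pred K _ _ (restriction A' H) beta p phi &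
                 psi = (fun g => Bbar A beta * phi g) in
  let d := @dbar K l (alpha H) p in
  [/\ forall theta, D theta -> D' theta,
      forall theta, D' theta -> DHB (d theta)
    & left_exact (fun _ => 0) D D' (fun theta => theta) d].
Proof.
(* In degree 0 the boundary is zero and both logarithmic conditions say only that [theta] is a
   multiderivation. *)
case: p le_pl => [|q] _ form A' D D' DHB d.
  split=> // [theta thetaP|].
    exists (fun _ => 0) => //.
    by apply: functional_extensionality => g; rewrite mulr0.
  by split=> // theta thetaP; split=> // _; exists theta.
split.
- by move=> theta [mt dvd]; split=> // X /deletionP[XA _]; apply: dvd.
- move=> theta thetaP; have dvd := Bbar_dvd arrA HA alphaP betaP thetaP.
  (* The quotient is chosen pointwise; regularity of [Bbar] then makes it a multiderivation. *)
  pose phi g := epsilon (inhabits 0) (fun c => d theta g = Bbar A beta * c).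
  have phiE : d theta = fun g => Bbar A beta * phi g.
    apply: functional_extensionality => g; rewrite /phi.
    apply: (epsilon_spec (inhabits 0) (fun c => d theta g = Bbar A beta * c)).
    by have [c Ec] := dvd g; exists c; rewrite mulrC.
  exists phi => //.
  have mphi : is_multider phi.
    apply: (multider_div (Bbar_lreg arrA HA alphaP betaP)).
    by rewrite -phiE; apply: dbar_multider thetaP.1.
  clearbody phi; rewrite /logder_pred; move: theta thetaP dvd phi phiE mphi.
  (* For q = 0 the target D^0 asks only for a multiderivation; the logarithmic condition starts at
     the next degree. *)
  rewrite {}/d {}/DHB {}/D' {}/D; case: q => [|q] // theta thetaP _ phi phiE mphi.
  split=> // X XA g; apply: (beta_dvd_quotient arrA HA alphaP betaP XA).
  have := fiber_poly_dvd_beta arrA HA alphaP betaP g thetaP XA.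
  by have -> : dbar theta [tuple of beta X :: g] = _ := congr1 (@^~ _) phiE.
split=> // theta thetaP; split=> [d0|[_ /[swap] -> thetaD]].
  exists theta => //; split=> [|X XA f]; first exact: thetaP.1.
  (* Only the hyperplane [H] is new, and its condition is exactly the vanishing of the boundary
     modulo [alpha H]. *)
  have [->|neq] := eqVneq X H; last by apply: thetaP.2; rewrite !inE neq.
  rewrite -[theta _]subr0; apply/bar_eqP; rewrite rmorph0.
  by rewrite -(dbarE _ f thetaP.1) [LHS](congr1 (@^~ _) d0).
apply: functional_extensionality => g.
rewrite /d /dbar -(rmorph0 (bar _)); apply/bar_eqP; rewrite subr0.
exact: thetaD.2.
Qed.
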